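(* Let $F$ be a probability distribution with a positive Lebesgue density $f$ on $(0,\infty)$ and hazard rate $h=f/\overline F$, and assume $\gamma_f<\infty$. Then $F\in\mathcal{D}\cap\mathcal{L}$, and for every $\gamma>\gamma_f$ there are positive constants $x_0'=x_0'(\gamma)$ and $C'(\gamma)$ for which the Potter-type inequality $$\frac{f(y)}{f(x)}\ge C'(\gamma)\left(\frac{y}{x}\right)^{-\gamma},\qquad y\ge x\ge x_0',$$ holds and such that, for all $x\ge x_0'$ and all $\lambda>1$, $$x\,h(x)\le\frac{1}{C'(\gamma)\,V(\lambda,\gamma)},$$ where $V(\lambda,\gamma)=(\lambda^{-\gamma+1}-1)/(-\gamma+1)$ if $\gamma\ne1$ and $V(\lambda,\gamma)=\log\lambda$ if $\gamma=1$.
   Context: $\overline F=1-F$ is the right tail of $F$. $F\in\mathcal{D}$ (dominatedly varying tail) means that $\liminf_{x\to\infty}\overline F(ux)/\overline F(x)>0$ for all (equivalently, for some) $u>1$. $F\in\mathcal{L}$ (long tail) means that $\lim_{x\to\infty}\overline F(x-y)/\overline F(x)=1$ for every $y\in(-\infty,\infty)$. For a positive function $g$ on $(0,\infty)$, the (sign-normalized) upper Matuszewska index $\gamma_g\in[-\infty,\infty]$ is the infimum of those $\gamma\in\mathbb{R}$ for which there is a constant $D>0$ such that for every $U>1$, as $x\to\infty$, $g(ux)/g(x)\ge D(1+o(1))u^{-\gamma}$ uniformly in $u\in[1,U]$ (with $\inf\emptyset=\infty$). *)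

(* Defs.v *)
From HB Require Import structures.
From mathcomp Require Import all_boot all_order all_algebra.
From mathcomp Require Import all_classical all_reals all_analysis.

Set Implicit Arguments.
Unset Strict Implicit.
Unset Printing Implicit Defensive.

Import Order.TTheory GRing.Theory Num.Theory.
Import numFieldNormedType.Exports.

Local Open Scope classical_set_scope.
Local Open Scope ring_scope.

(* Distribution functions and right tails, real-valued; a distribution is given
   by its probability measure on the Borel sets of the real line. *)
Definition distr_fun (R : realType) (P : probability (measurableTypeR R) R)
  (x : R) : R := fine (P `]-oo, x]%classic).

Definition tail (R : realType) (P : probability (measurableTypeR R) R)
  (x : R) : R := 1 - distr_fun P x.

(* The values of [f] outside (0, +oo), and the mass of [P] there, are
   unconstrained. *)
Definition positive_density_on_pos (R : realType)
    (P : probability (measurableTypeR R) R) (f : R -> R) : Prop :=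
  [/\ forall x, 0 < x -> 0 < f x,
      measurable_fun (`]0, +oo[ : set R) f &
      forall A : set R, measurable A -> A `<=` `]0, +oo[ ->
        P A = (\int[lebesgue_measure]_(x in A) (f x)%:E)%E].

Definition hazard_rate (R : realType) (P : probability (measurableTypeR R) R)
  (f : R -> R) (x : R) : R := f x / tail P x.

Definition dominatedly_varying (R : realType)
    (P : probability (measurableTypeR R) R) : Prop :=
  forall u : R, 1 < u ->
    (0 < limf_einf (fun x : R => (tail P (u * x) / tail P x)%:E)
           (pinfty_nbhs R))%E.

Definition long_tailed (R : realType)
    (P : probability (measurableTypeR R) R) : Prop :=
  forall y : R, tail P (x - y) / tail P x @[x --> +oo] --> (1 : R).

(* [e x] is the o(1) term: it depends on [U] but not on [u], which is the
   uniformity in [u]. *)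
Definition potter_exponent (R : realType) (g : R -> R) (gamma : R) : Prop :=
  exists2 D : R, 0 < D &
    forall U : R, 1 < U ->
      exists2 e : R -> R, e x @[x --> +oo] --> (0 : R) &
        \forall x \near +oo, forall u : R, 1 <= u <= U ->
          D * (1 + e x) * u `^ (- gamma) <= g (u * x) / g x.

(* The sign is opposite to the usual one: regular variation of [g] with
   index -a gives a. The infimum of the empty set is +oo. *)
Definition matuszewska_index (R : realType) (g : R -> R) : \bar R :=
  ereal_inf [set gamma%:E | gamma in potter_exponent g].

Definition potter_V (R : realType) (lambda gamma : R) : R :=
  if gamma == 1 then ln lambda
  else (lambda `^ (- gamma + 1) - 1) / (- gamma + 1).

(* Main.v *)
Require Import Defs.
From HB Require Import structures.
From mathcomp Require Import all_boot all_order all_algebra.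
From mathcomp Require Import all_classical all_reals all_analysis.
From mathcomp Require Import measurable_realfun ring lra.

Import Order.TTheory GRing.Theory Num.Theory.
Import numFieldNormedType.Exports.

Local Open Scope classical_set_scope.
Local Open Scope ring_scope.

(** Fix [gamma' < gamma] admissible in the definition of the index, with constant [D].
    Choosing [U] with [(D / 2) * U `^ (gamma - gamma') >= 1], the bound over one period
    [[x, U x]] chains along [x, U x, U^2 x, ...] without loss, which gives the Potter
    inequality with constant [D / 2]. Integrating it over [[x, lambda x]] bounds the tail
    from below by [C x f(x) V(lambda, gamma)]; in particular [x h(x) <= K] for large [x].
    Since the tail decreases, this yields [f <= K tail(a) / a] on [[a, +oo[], hence
    [tail(b) >= (1 - K (b - a) / a) tail(a)] for [a <= b]. With [b = a + y] this is the
    long-tail property; with [b <= (1 + 1 / (2 K)) a] the tail loses at most a factor 2,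
    and finitely many such steps give dominated variation. *)

(** * Potter's inequality by chaining over geometric periods *)

(** Bernoulli's inequality in the form [n%:R * (q - 1) <= q ^+ n], with the Archimedean property. *)
Lemma expr_unbounded {R : realType} (c q : R) : 1 < q ->
  exists n, c <= q ^+ n.
Proof.
move=> q1; have q10 : 0 < q - 1 by rewrite subr_gt0.
exists (Num.bound (`|c| / (q - 1))); apply: le_trans (ler_norm c) _.
have /archi_boundP/ltW : 0 <= `|c| / (q - 1) by rewrite divr_ge0// ltW.
rewrite ler_pdivrMr// => h; apply: le_trans h _.
elim: (Num.bound _) => [|n IH]; first by rewrite mul0r expr0.
rewrite exprS -natr1.
have : 1 <= q ^+ n by rewrite exprn_ege1// ltW.
nra.
Qed.

Lemma powR_unbounded {R : realType} (c s : R) : 0 < s ->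
  exists2 U : R, 1 < U & c <= U `^ s.
Proof.
move=> s0; exists (1 + `|c| `^ s^-1 + 1).
  have := powR_ge0 `|c| s^-1; lra.
apply: le_trans (ler_norm c) _.
rewrite [leLHS](_ : _ = (`|c| `^ s^-1) `^ s); last first.
  by rewrite -powRrM mulVf ?powRr1// gt_eqF.
by apply: ge0_ler_powR; rewrite ?nnegrE ?(ltW s0)//; have := powR_ge0 `|c| s^-1; lra.
Qed.

(** Full periods are crossed with constant 1, so the factor [c] is paid only once, on the last
    incomplete period. The induction peels off the first period [[x, U x]]. *)
Lemma potter_chain {R : realType} (f : R -> R) (x0 c U gamma : R) :
    0 < x0 -> 1 < U -> 0 < c ->
    (forall x, 0 < x -> 0 < f x) ->
    (forall x y, x0 <= x -> x <= y <= U * x ->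
      c * (y / x) `^ (- gamma) <= f y / f x) ->
    (forall x, x0 <= x -> U `^ (- gamma) <= f (U * x) / f x) ->
  forall x y, x0 <= x -> x <= y -> c * (y / x) `^ (- gamma) <= f y / f x.
Proof.
move=> x00 U1 c0 f0 base step.
have main n : forall x y, x0 <= x -> x <= y <= U ^+ n.+1 * x ->
    c * (y / x) `^ (- gamma) <= f y / f x.
  elim: n => [x y xx0|n IH x y xx0 /andP[xy yU]].
    by rewrite expr1; exact: base.
  have x_gt0 : 0 < x by exact: lt_le_trans xx0.
  have [yUx|Uxy] := leP y (U * x); first by apply: base => //; rewrite xy.
  have Ux_gt0 : 0 < U * x by rewrite mulr_gt0//; lra.
  have x0Ux : x0 <= U * x by apply: le_trans xx0 _; rewrite ler_peMl// ltW.
  have h1 : c * (y / (U * x)) `^ (- gamma) <= f y / f (U * x).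
    by apply: IH => //; rewrite (ltW Uxy)/= mulrA -exprSr.
  have h2 := step x xx0.
  have -> : f y / f x = f y / f (U * x) * (f (U * x) / f x).
    by rewrite mulrA divfK// gt_eqF// f0.
  have -> : y / x = y / (U * x) * U by field; rewrite !gt_eqF//; lra.
  rewrite powRM ?divr_ge0//; [|lra..].
  by rewrite mulrA ler_pM ?mulr_ge0 ?powR_ge0// ltW.
move=> x y xx0 xy; have x_gt0 : 0 < x by exact: lt_le_trans xx0.
(* [main] starts at exponent 1; exponent 0 gives [y <= x], which falls in the first period. *)
have [[|n] yn] := expr_unbounded (y / x) U U1.
- apply: (main 0%N) => //; rewrite xy/= expr1.
  move: yn; rewrite expr0 ler_pdivrMr// mul1r => /le_trans; apply.
  by rewrite ler_peMl// ltW.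
- by apply: (main n) => //; rewrite xy/= -ler_pdivrMr.
Qed.

Lemma potter_bound {R : realType} (f : R -> R) (gamma : R) :
    (forall x, 0 < x -> 0 < f x) -> (matuszewska_index f < gamma%:E)%E ->
  exists x0 C : R, [/\ 0 < x0, 0 < C &
    forall x y, x0 <= x -> x <= y -> C * (y / x) `^ (- gamma) <= f y / f x].
Proof.
move=> f0 /ereal_inf_lt[_ [gamma' [D D0 fD] <-]]; rewrite lte_fin => gg.
have [|U U1 hU] := powR_unbounded (D / 2)^-1 (gamma - gamma').
  by rewrite subr_gt0.
have U0 : 0 < U by lra.
have [e e0 he] := fD U U1.
(* This turns [D * (1 + e x)] into at least [D / 2]. *)
have : \forall x \near +oo, - 1 / 2 < e x by apply: (cvgr_gt _ e0); lra.
move=> /(filterI he)/(filterI (nbhs_pinfty_gt (num_real 0))) [M [_ hM]].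
pose x0 := `|M| + 1; have x0M : M < x0 by rewrite /x0; have := ler_norm M; lra.
have x00 : 0 < x0 by rewrite /x0; have := normr_ge0 M; lra.
have base x y : x0 <= x -> x <= y <= U * x ->
    D / 2 * (y / x) `^ (- gamma') <= f y / f x.
  move=> xx0 /andP[xy yU]; have [x_gt0 [/(_ (y / x)) hx ex]] := hM _ (lt_le_trans x0M xx0).
  rewrite divfK ?gt_eqF// in hx; apply: le_trans (hx _).
    by rewrite ler_wpM2r ?powR_ge0//; nra.
  by rewrite ler_pdivlMr// mul1r xy ler_pdivrMr.
exists x0, (D / 2); split => //; first by rewrite divr_gt0.
apply: (@potter_chain _ f x0 (D / 2) U) => //.
- by rewrite divr_gt0.
(* As [y / x >= 1], replacing [gamma'] by the larger [gamma] only weakens the bound. *)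
- move=> x y xx0 xyU; have x_gt0 : 0 < x by exact: lt_le_trans xx0.
  apply: le_trans (base _ _ xx0 xyU); rewrite ler_wpM2l ?divr_ge0 ?(ltW D0)//.
  case/andP: xyU => xy _.
  by apply: ler_powR; [rewrite ler_pdivlMr// mul1r|lra].
(* Over a full period the surplus power of [U], with exponent [gamma - gamma'], compensates
   [D / 2]. *)
- move=> x xx0; have x_gt0 : 0 < x by exact: lt_le_trans xx0.
  apply: le_trans (base x (U * x) xx0 _); last by rewrite lexx andbT ler_peMl// ltW.
  rewrite mulfK ?gt_eqF//.
  have -> : - gamma' = (gamma - gamma') - gamma by lra.
  rewrite powRD; last by rewrite (gt_eqF U0) implybT.
  rewrite mulrA ler_peMl ?powR_ge0// -ler_pdivrMl ?mulr1//.
  by rewrite divr_gt0.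
Qed.

(** * The function V as an integral of a power *)

Lemma potter_V_gt0 {R : realType} (lambda gamma : R) :
  1 < lambda -> 0 < potter_V lambda gamma.
Proof.
move=> l1; rewrite /potter_V; have [_|g1] := eqVneq gamma 1; first exact: ln_gt0.
have l0 : 0 < ln lambda by exact: ln_gt0.
rewrite /powR gt_eqF; last by lra.
(* Numerator and denominator both have the sign of [- gamma + 1]. *)
have [s0|s0] : 0 < - gamma + 1 \/ - gamma + 1 < 0.
- by move: g1; rewrite neq_lt => /orP[]; [left|right]; lra.
- by rewrite divr_gt0// subr_gt0 expR_gt1 mulr_gt0.
- by rewrite -mulrNN -invrN divr_gt0// ?oppr_gt0 ?subr_lt0 ?expR_lt1 ?nmulr_rlt0.
Qed.

Lemma potter_V1 {R : realType} (gamma : R) : potter_V 1 gamma = 0.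
Proof.
by rewrite /potter_V ln1 powR1 subrr mul0r; case: ifP.
Qed.

(** Both branches of V are primitives of the same power, so the integration below needs no case
    distinction on [gamma = 1]. *)
Lemma is_derive_potter_V {R : realType} (gamma z : R) : 0 < z ->
  is_derive z 1 (fun l => potter_V l gamma) (z `^ (- gamma)).
Proof.
move=> z0; rewrite /potter_V; have [->|g1] := eqVneq gamma 1.
  by rewrite powR_inv1 ?ltW//; exact: is_derive1_ln.
have s0 : - gamma + 1 != 0 by apply: contra g1 => /eqP ?; apply/eqP; lra.
rewrite (_ : (fun l => _) =
    (- gamma + 1)^-1 *: ((@powR R ^~ (- gamma + 1)) - cst 1)); last first.
  by apply/funext => l /=; rewrite mulrC.
have dp := @is_derive1_powR R (- gamma + 1) z z0.
apply: is_derive_eq.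
by rewrite subr0 addrK scalerA mulVf// scale1r.
Qed.

Lemma integral_powR {R : realType} (x lambda gamma : R) : 0 < x -> 1 < lambda ->
  (\int[lebesgue_measure]_(y in `]x, (lambda * x)%R])
    ((y / x) `^ (- gamma))%:E)%E = (x * potter_V lambda gamma)%:E.
Proof.
move=> x0 l1.
have xlx : x < lambda * x by rewrite ltr_pMl.
(* The prefactor [x] cancels the [1 / x] of the chain rule, and [G x = 0] because V vanishes at
   1. *)
pose G (y : R) := x * potter_V (y / x) gamma.
have dq (y : R) : is_derive y 1 (fun t : R => t / x) x^-1.
  rewrite (_ : (fun _ => _) = x^-1 *: id); last by apply/funext => t; rewrite mulrC.
  by apply: is_derive_eq; rewrite /GRing.scale/= mulr1.
have dG (y : R) : 0 < y -> is_derive y 1 G ((y / x) `^ (- gamma)).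
  move=> y0; have yx0 : 0 < y / x by rewrite divr_gt0.
  have dV := is_derive_potter_V gamma _ yx0.
  have dc := @is_derive1_comp R (@potter_V R ^~ gamma) (fun t : R => t / x) y _ _ dV (dq y).
  rewrite (_ : G = x *: ((@potter_V R ^~ gamma) \o (fun t : R => t / x)))//.
  apply: is_derive_eq; rewrite /GRing.scale/=.
  by field; rewrite gt_eqF.
have cG (y : R) : 0 < y -> {for y, continuous G}.
  move=> y0; apply: differentiable_continuous; apply/derivable1_diffP.
  by have [] := dG y y0.
have mp : measurable_fun setT (fun y : R => (y / x) `^ (- gamma)).
  apply: (measurableT_comp (measurable_powR (- gamma))).
  exact: measurable_funM.
rewrite integral_itv_obnd_cbnd; last first.
  by apply/measurable_EFinP; apply: measurable_funTS.
rewrite (@continuous_FTC2 _ _ G)//.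
- by rewrite /G mulfK ?gt_eqF// divff ?gt_eqF// potter_V1 mulr0 sube0.
- apply: derivable_within_continuous => y; rewrite in_itv/= => /andP[xy _].
  have yx0 : 0 < y / x by rewrite divr_gt0//; lra.
  have dc := @is_derive1_comp R (@powR R ^~ (- gamma)) (fun t : R => t / x) y _ _
    (@is_derive1_powR R _ _ yx0) (dq y).
  by have [] := dc.
- split.
  + by move=> y; rewrite in_itv/= => /andP[xy _]; have [] := dG y (lt_trans x0 xy).
  + by apply: cvg_at_right_filter; apply: cG.
  + by apply: cvg_at_left_filter; apply: cG; lra.
- move=> y; rewrite in_itv/= => /andP[xy _].
  by have [_ ] := dG y (lt_trans x0 xy); rewrite derive1E.
Qed.

(** * Tail bounds from the density *)

Lemma tailE {R : realType} (P : probability (measurableTypeR R) R) (x : R) :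
  (tail P x)%:E = P `]x, +oo[%classic.
Proof.
rewrite /tail /distr_fun EFinB fineK ?fin_num_measure//.
by rewrite -probability_setC// setCitvl.
Qed.

Lemma tailB {R : realType} (P : probability (measurableTypeR R) R) (a b : R) :
  a <= b -> (tail P a - tail P b)%:E = P `]a, b]%classic.
Proof.
move=> ab; rewrite EFinB !tailE.
rewrite (@itv_bndbnd_setU _ _ (BRight a) (BRight b) +oo%O) ?bnd_simp//.
rewrite measureU//; first by rewrite addeK// fin_num_measure.
by apply/seteqP; split => y //=; rewrite !in_itv/= => -[/andP[_ yb]]; rewrite ltNge yb.
Qed.

Lemma le_tail {R : realType} (P : probability (measurableTypeR R) R) (a b : R) :
  a <= b -> tail P b <= tail P a.
Proof. by move=> ab; rewrite -subr_ge0 -lee_fin tailB. Qed.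

Lemma tail_ge0 {R : realType} (P : probability (measurableTypeR R) R) (x : R) :
  0 <= tail P x.
Proof. by rewrite -lee_fin tailE. Qed.

(** The mass of []x, lambda x]] alone suffices: there the density is at least [C * f x] times the
    power integrated in [integral_powR]. *)
Lemma tail_lower_bound {R : realType} (P : probability (measurableTypeR R) R)
    (f : R -> R) (C gamma x lambda : R) :
    positive_density_on_pos P f -> 0 < C -> 0 < x -> 1 < lambda ->
    (forall y, x <= y -> C * (y / x) `^ (- gamma) <= f y / f x) ->
  C * potter_V lambda gamma * (x * f x) <= tail P x.
Proof.
move=> [f0 mf Pf] C0 x0 l1 potter.
have xlx : x <= lambda * x by rewrite ler_peMl// ltW.
have sub : `]x, lambda * x]%classic `<=` (`]0, +oo[%classic : set R).
  by move=> y /=; rewrite !in_itv/= andbT => /andP[xy _]; exact: lt_trans xy.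
apply: (@le_trans _ _ (tail P x - tail P (lambda * x))); last first.
  by rewrite gerBl tail_ge0.
have -> : C * potter_V lambda gamma * (x * f x) =
  C * f x * (x * potter_V lambda gamma) by ring.
have Cf0 : 0 <= C * f x by rewrite mulr_ge0 ?ltW// f0.
have mp : measurable_fun setT (fun y : R => (y / x) `^ (- gamma)).
  apply: (measurableT_comp (measurable_powR (- gamma))).
  exact: measurable_funM.
rewrite -lee_fin tailB// Pf// EFinM -integral_powR// -ge0_integralZl//=; last 2 first.
- by apply/measurable_EFinP; apply: measurable_funTS.
- by move=> y _; rewrite lee_fin powR_ge0.
apply: ge0_le_integral => //=.
- by move=> y _; rewrite lee_fin mulr_ge0// powR_ge0.
- by apply: measurable_funeM; apply/measurable_EFinP; apply: measurable_funTS.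
- by apply/measurable_EFinP; exact: measurable_funS mf.
- move=> y; rewrite in_itv/= => /andP[/ltW xy _]; rewrite -EFinM lee_fin.
  have := potter y xy; rewrite ler_pdivlMr ?f0//.
  by apply: le_trans; rewrite le_eqVlt; apply/orP; left; apply/eqP; ring.
Qed.

Lemma tailB_le {R : realType} (P : probability (measurableTypeR R) R)
    (f : R -> R) (M a b : R) :
    positive_density_on_pos P f -> 0 <= a -> a <= b ->
    (forall y, a < y -> f y <= M) ->
  tail P a - tail P b <= M * (b - a).
Proof.
move=> [f0 mf Pf] a0 ab fM.
have sub : `]a, b]%classic `<=` (`]0, +oo[%classic : set R).
  by move=> y /=; rewrite !in_itv/= andbT => /andP[ay _]; exact: le_lt_trans ay.
rewrite -lee_fin tailB// Pf//.
apply: (@le_trans _ _ (\int[lebesgue_measure]_(x in `]a, b]) (cst M%:E x))%E).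
  apply: ge0_le_integral => //=.
  - by move=> y yab; rewrite lee_fin ltW// f0//; have := sub _ yab;
      rewrite /= in_itv/= andbT.
  - by apply/measurable_EFinP; exact: measurable_funS mf.
  - by move=> y; rewrite in_itv/= => /andP[ay _]; rewrite lee_fin fM.
rewrite integral_cst//= lebesgue_measure_itv/= lte_fin.
(* The length of an interval is given by cases; in the second one [a = b] and both sides vanish. *)
have [_|ba] := ltP a b; first by rewrite -EFinB -EFinM.
by rewrite mule0 lee_fin (le_anti (introT andP (conj ab ba))) subrr mulr0.
Qed.

(** * Consequences of a bound on x h(x) *)

(* The last premise is [x h(x) <= K] beyond [x0]. *)
Lemma tail_increment {R : realType} (P : probability (measurableTypeR R) R)
    (f : R -> R) (K x0 : R) :
    positive_density_on_pos P f -> 0 < x0 -> 0 < K ->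
    (forall x, x0 <= x -> x * f x <= K * tail P x) ->
  forall a b, x0 <= a -> a <= b -> (1 - K * ((b - a) / a)) * tail P a <= tail P b.
Proof.
move=> fP x00 K0 hK a b x0a ab; have a0 : 0 < a by exact: lt_le_trans x0a.
have h : tail P a - tail P b <= K * tail P a / a * (b - a).
  (* For [y > a]: [a * f y <= y * f y <= K * tail P y <= K * tail P a]. *)
  apply: (tailB_le P f _ _ _ fP (ltW a0) ab) => y ay.
  have y0 : 0 < y by exact: lt_trans ay.
  rewrite ler_pdivlMr//; apply: le_trans (_ : y * f y <= _).
    by rewrite mulrC ler_wpM2r ?ltW//; case: fP => + _ _; apply.
  apply: le_trans (hK _ (le_trans x0a (ltW ay))) _.
  by rewrite ler_wpM2l ?(ltW K0)// le_tail// ltW.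
rewrite mulrBl mul1r lerBlDr -lerBlDl.
by apply: le_trans h _; rewrite le_eqVlt; apply/orP; left; apply/eqP; ring.
Qed.

Lemma dominatedly_varying_of_hazard {R : realType}
    (P : probability (measurableTypeR R) R) (f : R -> R) (K x0 : R) :
    positive_density_on_pos P f -> 0 < x0 -> 0 < K ->
    (forall x, x0 <= x -> x * f x <= K * tail P x) ->
    (forall x, x0 <= x -> 0 < tail P x) ->
  dominatedly_varying P.
Proof.
move=> fP x00 K0 hK tail0 u u1.
have := tail_increment P f K x0 fP x00 K0 hK => incr.
have [n un] : exists n : nat, u <= (1 + (K * 2)^-1) ^+ n.
  by apply: expr_unbounded; rewrite ltrDl invr_gt0 mulr_gt0.
have main m : forall a b, x0 <= a -> a <= b -> b <= (1 + (K * 2)^-1) ^+ m * a ->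
    2^-1 ^+ m * tail P a <= tail P b.
  elim: m => [a b x0a ab|m IH a b x0a ab ba].
    by rewrite !expr0 !mul1r => ba; rewrite le_tail.
  have a0 : 0 < a by exact: lt_le_trans x0a.
  (* The ratio [q] is such that [K * ((c - a) / a) <= 1 / 2]; the minimum stops the step at [b] if
     [b] comes first. *)
  pose q := 1 + (K * 2)^-1; pose c := Num.min b (q * a).
  have q1 : 1 <= q by rewrite lerDl invr_ge0 mulr_ge0// ltW.
  have ac : a <= c by rewrite le_min ab ler_peMl// ltW.
  have cq : c <= q * a by rewrite ge_min lexx orbT.
  have h1 : 2^-1 * tail P a <= tail P c.
    apply: le_trans (incr a c x0a ac); rewrite ler_wpM2r ?tail_ge0//.
    have : (c - a) / a <= (K * 2)^-1.
      by rewrite ler_pdivrMr// lerBlDl -[X in X + _]mul1r -mulrDl.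
    have Kq : K * (K * 2)^-1 = 2^-1 by field; rewrite gt_eqF.
    by move=> /(ler_wpM2l (ltW K0)); rewrite Kq; lra.
  have h2 : 2^-1 ^+ m * tail P c <= tail P b.
    apply: IH; first exact: le_trans ac.
      by rewrite ge_min lexx.
    rewrite /c minEle; case: ifP => _.
      by rewrite ler_peMl ?exprn_ege1// (le_trans (ltW a0)).
    by rewrite mulrA -exprSr.
  apply: le_trans h2; rewrite exprSr -mulrA ler_wpM2l// exprn_ge0// invr_ge0//.
(* The lower limit is a supremum of infima over neighbourhoods of infinity; the single one [x0 <= x]
   already gives a positive infimum. *)
rewrite limf_einfE; apply: (@lt_le_trans _ _ (2^-1 ^+ n)%:E).
  by rewrite lte_fin exprn_gt0.
apply: le_trans (ereal_sup_ubound _); last first.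
  by exists [set x | x0 <= x] => //; exact: nbhs_pinfty_ge (num_real x0).
apply: le_ereal_inf_tmp => _ [x /= x0x <-]; rewrite lee_fin ler_pdivlMr ?tail0//.
have x_gt0 : 0 < x by exact: lt_le_trans x0x.
apply: main => //; first by rewrite ler_peMl// ltW.
by rewrite ler_wpM2r// ltW.
Qed.

Lemma long_tailed_of_hazard {R : realType}
    (P : probability (measurableTypeR R) R) (f : R -> R) (K x0 : R) :
    positive_density_on_pos P f -> 0 < x0 -> 0 < K ->
    (forall x, x0 <= x -> x * f x <= K * tail P x) ->
    (forall x, x0 <= x -> 0 < tail P x) ->
  long_tailed P.
Proof.
move=> fP x00 K0 hK tail0.
have incr := tail_increment P f K x0 fP x00 K0 hK.
(* Shifts to the right are squeezed between [1 - K * (y / x)] and 1. *)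
have right y : 0 <= y -> tail P (x + y) / tail P x @[x --> +oo] --> (1 : R).
  move=> y0; apply: (@squeeze_cvgr _ _ _ _ (fun x => 1 - K * (y / x)) (fun=> 1)).
  - near=> x.
    have x0x : x0 <= x by near: x; exact: nbhs_pinfty_ge (num_real x0).
    rewrite ler_pdivlMr ?tail0// ler_pdivrMr ?tail0// mul1r le_tail ?lerDl// andbT.
    by have := incr x (x + y) x0x; rewrite lerDl addrAC subrr add0r; apply.
  - suff : 1 - K * (y / x) @[x --> +oo] --> 1 - K * (y * 0) by rewrite !mulr0 subr0.
    apply: cvgB; first exact: cvg_cst.
    apply: cvgM; first exact: cvg_cst.
    apply: cvgM; first exact: cvg_cst.
    apply/gtr0_cvgV0; last exact: cvg_id.
    exact: nbhs_pinfty_gt (num_real 0).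
  - exact: cvg_cst.
move=> y; have [y0|y0] := leP y 0.
  by apply: (right (- y)); rewrite oppr_ge0.
(* A shift to the left is the reciprocal of a shift to the right, read at [x - y] instead of [x]. *)
have h : tail P (x - y) / tail P (x - y + y) @[x --> +oo] --> (1 : R).
  have /cvgV := right y (ltW y0); rewrite invr1 => /(_ (oner_neq0 _)) h.
  apply: (@cvg_comp _ _ _ (fun x => x - y) (fun x => tail P x / tail P (x + y)) _ +oo _).
    exact: cvg_addrr.
  by under eq_fun do rewrite -invf_div.
by move: h; under eq_fun do rewrite subrK.
Unshelve. all: by end_near. Qed.

Theorem proposition3p1 (R : realType) (P : probability (measurableTypeR R) R)
    (f : R -> R) (f_density : positive_density_on_pos P f)
    (index_lty : (matuszewska_index f < +oo)%E) :
  [/\ dominatedly_varying P, long_tailed P &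
    forall gamma : R, (matuszewska_index f < gamma%:E)%E ->
      exists x0 C : R,
        [/\ 0 < x0, 0 < C,
            forall x y : R, x0 <= x -> x <= y ->
              f y / f x >= C * (y / x) `^ (- gamma) &
            forall x lambda : R, x0 <= x -> 1 < lambda ->
              x * hazard_rate P f x <= 1 / (C * potter_V lambda gamma)]].
Proof.
have [f0 _ _] := f_density.
(* Used twice: for one auxiliary [gamma0], giving the two tail classes, and for the given [gamma].
   The strict positivity also shows that the tail does not vanish. *)
have lower gamma x0 C : 0 < x0 -> 0 < C ->
    (forall x y, x0 <= x -> x <= y -> C * (y / x) `^ (- gamma) <= f y / f x) ->
    forall x lambda, x0 <= x -> 1 < lambda ->
      0 < C * potter_V lambda gamma * (x * f x) <= tail P x.
  move=> x00 C0 potter x lambda x0x l1; have x_gt0 : 0 < x by exact: lt_le_trans x0x.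
  rewrite !mulr_gt0 ?potter_V_gt0 ?f0//=.
  by apply: (tail_lower_bound P f _ _ _ _ f_density) => // y; exact: potter.
have [gamma0 gamma0P] : exists gamma : R, (matuszewska_index f < gamma%:E)%E.
  have [_ [g fg <-] _] := ereal_inf_lt index_lty; exists (g + 1).
  apply: (@le_lt_trans _ _ g%:E); last by rewrite lte_fin ltrDl.
  by apply: ereal_inf_lbound; exists g.
have [x0 [C [x00 C0 potter]]] := potter_bound f gamma0 f0 gamma0P.
(* Any [lambda > 1] would do; the choice 2 gives [K] as the inverse of this quantity. *)
have V0 : 0 < C * potter_V 2 gamma0 by rewrite mulr_gt0// potter_V_gt0// ltr1n.
have tail0 x : x0 <= x -> 0 < tail P x.
  move=> x0x; have /andP[] := lower _ _ _ x00 C0 potter x 2 x0x (ltr1n _ _).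
  exact: lt_le_trans.
have hK x : x0 <= x -> x * f x <= (C * potter_V 2 gamma0)^-1 * tail P x.
  move=> x0x; rewrite ler_pdivlMl//.
  by have /andP[] := lower _ _ _ x00 C0 potter x 2 x0x (ltr1n _ _).
split.
- by apply: (dominatedly_varying_of_hazard P f _ _ f_density x00 _ hK tail0); rewrite invr_gt0.
- by apply: (long_tailed_of_hazard P f _ _ f_density x00 _ hK tail0); rewrite invr_gt0.
- move=> gamma /(potter_bound f _ f0)[x1 [D [x10 D0 potter1]]].
  exists x1, D; split => // x lambda x1x l1.
  have /andP[lt0 le0] := lower _ _ _ x10 D0 potter1 x lambda x1x l1.
  (* The tail is positive by [lt0] and [le0], so the hazard rate is a genuine quotient. *)
  rewrite /hazard_rate mulrA ler_pdivrMr ?(lt_le_trans lt0)//.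
  by rewrite div1r ler_pdivlMl// mulr_gt0// potter_V_gt0.
Qed.
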